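(* Let $p\ge 2$, let $\mathcal{O}\subset\mathbb{R}^p$ be a connected open subset, let $f=f(\vec x)$ be a smooth real-valued function on $\mathcal{O}$, and let $H=(H_{ij})$ with $H_{ij}:=\partial_i^x\partial_j^xf$ be its Hessian. Let $(M_f,g_f)$ be the pseudo-Riemannian manifold of signature $(p,p)$ given by $M_f:=\mathcal{O}\times\mathbb{R}^p$, with coordinates $(\vec x,\vec y)$, $\vec x=(x_1,\dots,x_p)$, $\vec y=(y_1,\dots,y_p)$, and $$g_f(\partial_i^x,\partial_j^x):=\partial_i^xf\cdot\partial_j^xf,\quad g_f(\partial_i^x,\partial_j^y)=g_f(\partial_j^y,\partial_i^x)=\delta_{ij},\quad g_f(\partial_i^y,\partial_j^y)=0.$$ Assume $\operatorname{Rank}(H)\ge 2$ (at every point of $\mathcal{O}$). Then $(M_f,g_f)$ is: (1) spacelike Jordan Ivanov-Petrova if and only if $\det(H)$ is never zero; (2) timelike Jordan Ivanov-Petrova if and only if $\det(H)$ is never zero; (3) $k$-spacelike and $k$-timelike Jordan Stanilov for $2\le k\le p$ for any such $f$.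
   Context: Let $(M,g)$ be a pseudo-Riemannian manifold with Riemann curvature tensor $R$ of the Levi-Civita connection and curvature operator $R(x,y)$ determined by $R(x,y,z,w)=g(R(x,y)z,w)$. A linear subspace of $T_PM$ is spacelike (resp. timelike) if the restriction of $g_P$ to it is positive (resp. negative) definite. For an oriented spacelike or timelike $2$-plane $\pi\subset T_PM$ with oriented orthonormal basis $\{e_1,e_2\}$, the skew-symmetric curvature operator is $\mathcal{R}(\pi):=R(e_1,e_2)$ (independent of the basis). $(M,g)$ is spacelike (resp. timelike) Jordan Ivanov-Petrova if for every $P\in M$ the Jordan normal form (conjugacy class) of $\mathcal{R}(\pi)$ is the same for all oriented spacelike (resp. timelike) $2$-planes $\pi\subset T_PM$. For an unoriented spacelike or timelike $k$-plane $\pi\subset T_PM$ with orthonormal basis $\{e_1,\dots,e_k\}$, the higher order curvature operator is $\Theta(\pi):=\sum_{i,j}R(e_i,e_j)R(e_i,e_j)$ (independent of the basis). $(M,g)$ is $k$-spacelike (resp. $k$-timelike) Jordan Stanilov if for every $P\in M$ the Jordan normal form of $\Theta(\pi)$ is the same for all spacelike (resp. timelike) $k$-planes $\pi\subset T_PM$. In all cases the Jordan normal form is allowed to vary with $P$. Here $\partial_i^x=\partial/\partial x_i$ and $\partial_i^y=\partial/\partial y_i$. *)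

(* Defs.v *)
From HB Require Import structures.
From mathcomp Require Import all_boot all_order all_algebra.
From mathcomp Require Import all_classical all_reals all_analysis.
From mathcomp Require Import ring lra.
Set Implicit Arguments.
Unset Strict Implicit.
Unset Printing Implicit Defensive.
Import Order.TTheory GRing.Theory Num.Theory.
Import numFieldNormedType.Exports.
Local Open Scope classical_set_scope.
Local Open Scope ring_scope.

(* Everything takes place on an open subset U of R^n, which carries a global
   chart.  Points and tangent vectors are row vectors 'rV[R]_n, and a linear
   map A of the tangent space is the matrix acting by v |-> v *m A. *)

Section Calculus.
Context {R : realType} {n : nat}.
Implicit Types (h : 'rV[R]_n -> R) (U : set 'rV[R]_n).

Definition partial (i : 'I_n) h : 'rV[R]_n -> R :=
  fun P => 'D_(delta_mx 0 i) h P.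

Fixpoint iter_partial (s : seq 'I_n) h : 'rV[R]_n -> R :=
  if s is i :: s' then iter_partial s' (partial i h) else h.

(* C^infty on the open set U: all iterated partial derivatives exist and are
   continuous on U.  The values of h outside U play no role. *)
Definition smooth_on U h : Prop :=
  forall (s : seq 'I_n) (P : 'rV[R]_n), U P ->
    {for P, continuous (iter_partial s h)} /\
    (forall i : 'I_n, derivable (iter_partial s h) P (delta_mx 0 i)).

Definition hessian h (P : 'rV[R]_n) : 'M[R]_n :=
  \matrix_(i, j) partial i (partial j h) P.

End Calculus.

Section PseudoRiemannian.
Context {R : realType} {n : nat}.
(* g P is the Gram matrix of the metric at P in the coordinate frame. *)
Implicit Types (g : 'rV[R]_n -> 'M[R]_n) (G : 'M[R]_n) (U : set 'rV[R]_n).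

Definition inner G (v w : 'rV[R]_n) : R := (v *m G *m w^T) 0 0.

(* Gamma i j l is the coefficient of d_l in nabla_{d_i} d_j at P; the two
   clauses are vanishing torsion and nabla g = 0. *)
Definition levi_civita_at g (P : 'rV[R]_n) (Gamma : 'I_n -> 'I_n -> 'I_n -> R)
  : Prop :=
  (forall i j l, Gamma i j l = Gamma j i l) /\
  (forall k i j, partial k (fun Q => g Q i j) P =
     \sum_l (Gamma k i l * g P l j + Gamma k j l * g P i l)).

Definition christoffel g (i j l : 'I_n) (P : 'rV[R]_n) : R :=
  2^-1 * \sum_m invmx (g P) m l *
    (partial i (fun Q => g Q j m) P + partial j (fun Q => g Q i m) P
     - partial m (fun Q => g Q i j) P).

(* The coefficient of d_l in R(d_i, d_j) d_k, for the sign convention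
   R(x, y) = nabla_x nabla_y - nabla_y nabla_x - nabla_[x, y]. *)
Definition riemann g (i j k l : 'I_n) (P : 'rV[R]_n) : R :=
  partial i (christoffel g j k l) P - partial j (christoffel g i k l) P
  + \sum_m (christoffel g j k m P * christoffel g i m l P
            - christoffel g i k m P * christoffel g j m l P).

Definition curvature_op g (P x y : 'rV[R]_n) : 'M[R]_n :=
  \matrix_(k, l) \sum_i \sum_j x 0 i * y 0 j * riemann g i j k l P.

Definition spacelike G (W : {vspace 'rV[R]_n}) : Prop :=
  forall v, v \in W -> v != 0 -> 0 < inner G v v.

Definition timelike G (W : {vspace 'rV[R]_n}) : Prop :=
  forall v, v \in W -> v != 0 -> inner G v v < 0.

(* Orthonormal in the indefinite sense: on a timelike space the inner products
   of the basis vectors with themselves are -1. *)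
Definition orthonormal_basis k G (W : {vspace 'rV[R]_n})
  (e : k.-tuple 'rV[R]_n) : Prop :=
  [/\ basis_of W e,
      (forall i, `|inner G (tnth e i) (tnth e i)| = 1) &
      (forall i j, i != j -> inner G (tnth e i) (tnth e j) = 0)].

Definition skew_curvature_op g (P : 'rV[R]_n) (e : 2.-tuple 'rV[R]_n)
  : 'M[R]_n :=
  curvature_op g P (tnth e ord0) (tnth e ord_max).

Definition stanilov_op k g (P : 'rV[R]_n) (e : k.-tuple 'rV[R]_n) : 'M[R]_n :=
  \sum_i \sum_j curvature_op g P (tnth e i) (tnth e j) *m
                curvature_op g P (tnth e i) (tnth e j).

(* Every orthonormal basis of a plane is oriented for exactly one of its two
   orientations, so e and e' range over the oriented orthonormal bases of all
   oriented planes; e and e' may span the same plane with opposite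
   orientations. *)
Definition jordan_ivanov_petrova
  (causal : 'M[R]_n -> {vspace 'rV[R]_n} -> Prop) U g : Prop :=
  forall P, U P ->
  forall (W W' : {vspace 'rV[R]_n}) (e e' : 2.-tuple 'rV[R]_n),
    causal (g P) W -> causal (g P) W' ->
    orthonormal_basis (g P) W e -> orthonormal_basis (g P) W' e' ->
    similar_in unitmx (skew_curvature_op g P e) (skew_curvature_op g P e').

Definition spacelike_jordan_IP := jordan_ivanov_petrova spacelike.
Definition timelike_jordan_IP := jordan_ivanov_petrova timelike.

Definition jordan_stanilov
  (causal : 'M[R]_n -> {vspace 'rV[R]_n} -> Prop) (k : nat) U g : Prop :=
  forall P, U P ->
  forall (W W' : {vspace 'rV[R]_n}) (e e' : k.-tuple 'rV[R]_n),
    causal (g P) W -> causal (g P) W' ->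
    orthonormal_basis (g P) W e -> orthonormal_basis (g P) W' e' ->
    similar_in unitmx (stanilov_op g P e) (stanilov_op g P e').

Definition spacelike_jordan_stanilov := jordan_stanilov spacelike.
Definition timelike_jordan_stanilov := jordan_stanilov timelike.

End PseudoRiemannian.

(* p timelike and q spacelike directions. *)
Record pseudo_riemannian {R : realType} (p q : nat) (U : set 'rV[R]_(p + q))
  (g : 'rV[R]_(p + q) -> 'M[R]_(p + q)) : Prop := PseudoRiemannian {
  pr_open : open U;
  pr_smooth : forall i j, smooth_on U (fun P => g P i j);
  pr_sym : forall P, U P -> (g P)^T = g P;
  pr_signature : forall P, U P -> exists2 E : 'M[R]_(p + q),
    E \in unitmx & E *m g P *m E^T = block_mx (- 1%:M) 0 0 1%:M }.

Section TheManifold.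
Context {R : realType} {p : nat}.
Implicit Types (O : set 'rV[R]_p) (f : 'rV[R]_p -> R).

(* A point of R^p x R^p is the concatenation row_mx x y. *)
Definition Mdom O : set 'rV[R]_(p + p) := [set P | O (lsubmx P)].

Definition gmetric f (P : 'rV[R]_(p + p)) : 'M[R]_(p + p) :=
  block_mx (\matrix_(i, j) (partial i f (lsubmx P) * partial j f (lsubmx P)))
           1%:M
           1%:M 0.

End TheManifold.

Lemma partial_eq_on {R : realType} {n : nat} (U : set 'rV[R]_n) h1 h2 i P :
  open U -> (forall Q, U Q -> h1 Q = h2 Q) -> U P ->
  partial i h1 P = partial i h2 P.
Proof.
move=> oU eqh UP; apply: near_eq_derive.
by near=> Q; apply: eqh; near: Q; apply: open_nbhs_nbhs.
Unshelve. all: by end_near. Qed.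

(* Existence and uniqueness of the Levi-Civita connection: its coefficients are
   the Christoffel symbols. *)
Lemma levi_civita_christoffel {R : realType} {n : nat} (U : set 'rV[R]_n)
  (g : 'rV[R]_n -> 'M[R]_n) (P : 'rV[R]_n) Gamma :
  open U -> (forall Q, U Q -> (g Q)^T = g Q) -> U P -> g P \in unitmx ->
  levi_civita_at g P Gamma <->
  (forall i j l, Gamma i j l = christoffel g i j l P).
Proof.
move=> oU gsym UP gu.
pose d k i j := partial k (fun Q => g Q i j) P.
have gs i j : g P i j = g P j i by rewrite -{1}(gsym _ UP) mxE.
have ds k i j : d k i j = d k j i.
  rewrite /d; apply: (partial_eq_on k oU _ UP) => Q UQ.
  by rewrite -{1}(gsym _ UQ) mxE.
have chE i j l : christoffel g i j l P =
    2^-1 * \sum_m invmx (g P) m l * (d i j m + d j i m - d m i j) by [].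
have lowK (c : 'I_n -> R) m :
    \sum_l (\sum_m' invmx (g P) m' l * c m') * g P l m = c m.
  transitivity (\sum_m' c m' * (invmx (g P) *m g P) m' m).
    under eq_bigr do rewrite mulr_suml.
    rewrite exchange_big; apply: eq_bigr => m' _ /=.
    rewrite mxE mulr_sumr; apply: eq_bigr => l _; ring.
  rewrite mulVmx// (bigD1 m)//= mxE eqxx mulr1 big1 ?addr0// => i /negPf im.
  by rewrite mxE im mulr0.
have raiseK (c : 'I_n -> R) l :
    \sum_m invmx (g P) m l * (\sum_l' c l' * g P l' m) = c l.
  transitivity (\sum_l' c l' * (g P *m invmx (g P)) l' l).
    under eq_bigr do rewrite mulr_sumr.
    rewrite exchange_big; apply: eq_bigr => m' _ /=.
    rewrite mxE mulr_sumr; apply: eq_bigr => l' _; ring.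
  rewrite mulmxV// (bigD1 l)//= mxE eqxx mulr1 big1 ?addr0// => i /negPf im.
  by rewrite mxE im mulr0.
split=> [[tors comp] i j l|GE].
  pose L i j m := \sum_l Gamma i j l * g P l m.
  have dL k a b : d k a b = L k a b + L k b a.
    rewrite /d comp big_split; congr +%R.
    by apply: eq_bigr => q _; rewrite gs.
  have Ls a b m : L a b m = L b a m by apply: eq_bigr => q _; rewrite tors.
  rewrite chE -[LHS](raiseK (Gamma i j)) mulr_sumr; apply: eq_bigr => m _.
  rewrite -/(L i j m) !dL (Ls j i) (Ls m i) (Ls m j).
  by field.
split=> [i j l|k i j].
  rewrite !GE !chE; congr (_ * _); apply: eq_bigr => m _.
  by rewrite (ds m i j); ring.
have L a b m : \sum_l christoffel g a b l P * g P l m =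
    2^-1 * (d a b m + d b a m - d m a b).
  under eq_bigr do rewrite chE -mulrA.
  by rewrite -mulr_sumr (lowK (fun m => d a b m + d b a m - d m a b)).
rewrite -/(d k i j) big_split /=.
under eq_bigr do rewrite GE.
under [X in _ + X]eq_bigr do rewrite GE gs.
by rewrite !L (ds k j i); field.
Qed.

Lemma eq_smooth_at {R : realType} {n : nat} (U : set 'rV[R]_n) h1 h2
  (s : seq 'I_n) P :
  open U -> (forall Q, U Q -> h1 Q = h2 Q) -> U P ->
  {for P, continuous (iter_partial s h1)} /\
    (forall i, derivable (iter_partial s h1) P (delta_mx 0 i)) ->
  {for P, continuous (iter_partial s h2)} /\
    (forall i, derivable (iter_partial s h2) P (delta_mx 0 i)).
Proof.
move=> oU eqh UP [c d].
have E : forall Q, U Q -> iter_partial s h1 Q = iter_partial s h2 Q.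
  elim: s h1 h2 eqh {c d} => //= i s IH h1 h2 eqh; apply: IH => Q.
  exact: partial_eq_on.
have nE : \forall Q \near P, iter_partial s h1 Q = iter_partial s h2 Q.
  by near=> Q; apply: E; near: Q; apply: open_nbhs_nbhs.
split=> [|i]; last exact: near_eq_derivable (nE) (d i).
rewrite /prop_for /continuous_at -(E _ UP); apply: cvg_trans c.
exact: near_eq_cvg nE.
Unshelve. all: by end_near. Qed.

Lemma smooth_on_closed {R : realType} {n : nat} (U : set 'rV[R]_n)
  (C : ('rV[R]_n -> R) -> Prop) :
  open U ->
  (forall h P, C h -> U P -> {for P, continuous h} /\
     forall i, derivable h P (delta_mx 0 i)) ->
  (forall h i, C h -> exists2 h', C h' & forall P, U P -> h' P = partial i h P) ->
  forall h, C h -> smooth_on U h.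
Proof.
move=> oU C0 CS h Ch s; elim: s h Ch => [|i s IH] h Ch P UP; first exact: C0.
have [h' Ch' E] := CS h i Ch.
by apply: (eq_smooth_at oU E UP); apply: IH.
Qed.

Lemma smooth_on_partial {R : realType} {n : nat} (U : set 'rV[R]_n) h i :
  smooth_on U h -> smooth_on U (partial i h).
Proof. by move=> sh s; apply: (sh (i :: s)). Qed.

Lemma smooth_on_cst {R : realType} {n : nat} (U : set 'rV[R]_n) c :
  smooth_on U (fun=> c).
Proof.
move=> s; elim: s c => [|i s IH] c P UP /=.
  by split=> [|i]; [exact: cst_continuous|exact: derivable_cst].
suff -> : partial i (fun=> c) = (fun=> 0) by exact: IH.
by apply/funext => Q; rewrite /partial derive_cst.
Qed.

Inductive smooth_alg {R : realType} {n : nat} (U : set 'rV[R]_n) :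
  ('rV[R]_n -> R) -> Prop :=
| smooth_alg_base h of smooth_on U h : smooth_alg U h
| smooth_alg_add h1 h2 of smooth_alg U h1 & smooth_alg U h2 :
    smooth_alg U (h1 + h2)
| smooth_alg_mul h1 h2 of smooth_alg U h1 & smooth_alg U h2 :
    smooth_alg U (h1 * h2).

Lemma smooth_alg_C0 {R : realType} {n : nat} (U : set 'rV[R]_n) h P :
  U P -> smooth_alg U h ->
  {for P, continuous h} /\ forall i, derivable h P (delta_mx 0 i).
Proof.
move=> UP; elim=> {h} [h /(_ [::] P UP)//|h1 h2 _ [c1 d1] _ [c2 d2]
  |h1 h2 _ [c1 d1] _ [c2 d2]]; split=> [|i].
- exact: continuousD.
- exact: derivableD.
- exact: continuousM.
- exact: derivableM.
Qed.

Lemma smooth_onM {R : realType} {n : nat} (U : set 'rV[R]_n) h1 h2 :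
  open U -> smooth_on U h1 -> smooth_on U h2 -> smooth_on U (h1 * h2).
Proof.
move=> oU s1 s2; apply: (smooth_on_closed (C := smooth_alg U) oU); last first.
- by apply: smooth_alg_mul; apply: smooth_alg_base.
- move=> h i; elim=> {h1 h2 s1 s2 h} [h sh|h1 h2 a1 [k1 c1 e1] a2 [k2 c2 e2]
    |h1 h2 a1 [k1 c1 e1] a2 [k2 c2 e2]].
  + by exists (partial i h) => //; apply/smooth_alg_base/smooth_on_partial.
  + exists (k1 + k2); first exact: smooth_alg_add.
    move=> P UP; have [_ d1] := smooth_alg_C0 UP a1.
    have [_ d2] := smooth_alg_C0 UP a2.
    by rewrite /partial deriveD// -!/(partial _ _ _) -e1// -e2.
  + exists (h1 * k2 + h2 * k1).
      by apply: smooth_alg_add; apply: smooth_alg_mul.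
    move=> P UP; have [_ d1] := smooth_alg_C0 UP a1.
    have [_ d2] := smooth_alg_C0 UP a2.
    by rewrite /partial deriveM// -!/(partial _ _ _) -e1// -e2.
- by move=> h P a UP; apply: smooth_alg_C0 a.
Qed.

Lemma smooth_on_lsubmx {R : realType} {m n : nat} (U : set 'rV[R]_m) h :
  open U -> smooth_on U h ->
  smooth_on [set P : 'rV[R]_(m + n) | U (lsubmx P)] (fun P => h (lsubmx P)).
Proof.
move=> oU sh.
pose C k := exists2 h0, smooth_on U h0 &
  k = (fun P : 'rV[R]_(m + n) => h0 (lsubmx P)).
have oV : open [set P : 'rV[R]_(m + n) | U (lsubmx P)].
  by apply: (open_comp _ oU) => P _; exact: continuous_lsubmx.
pose k0 h0 (P : 'rV[R]_(m + n)) : R := h0 (lsubmx P).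
have quot h0 (P v : 'rV[R]_(m + n)) :
    (fun t => t^-1 *: ((k0 h0 \o shift P) (t *: v) - k0 h0 P)) =
    (fun t => t^-1 *: ((h0 \o shift (lsubmx P)) (t *: lsubmx v)
                       - h0 (lsubmx P))).
  apply/funext => t; rewrite /k0 /=; congr (_ *: (h0 _ - _)).
  by apply/rowP => q; rewrite !mxE.
have derE h0 P v : 'D_v (k0 h0) P = 'D_(lsubmx v) h0 (lsubmx P).
  by rewrite /derive quot.
have derbE h0 P v : derivable (k0 h0) P v =
    derivable h0 (lsubmx P) (lsubmx v).
  by rewrite /derivable quot.
have dl (j : 'I_m) : lsubmx (delta_mx 0 (lshift n j) : 'rV[R]_(m + n)) =
    delta_mx 0 j.
  by apply/rowP => q; rewrite !mxE !eqxx (inj_eq (@lshift_inj _ _)).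
have dr (j : 'I_n) : lsubmx (delta_mx 0 (rshift m j) : 'rV[R]_(m + n)) = 0.
  by apply/rowP => q; rewrite !mxE eq_lrshift.
apply: (smooth_on_closed (C := C) oV); last by exists h.
- move=> _ P [h0 s0 ->] UP; have [c d] := s0 [::] _ UP; split.
    by apply: (continuous_comp _ c); exact: continuous_lsubmx.
  move=> i; rewrite -/(k0 h0) derbE.
  case: (split_ordP i) => j ->; rewrite ?dl ?dr; first exact: d.
  exact: derivable0.
- move=> _ i [h0 s0 ->]; rewrite -/(k0 h0).
  case: (split_ordP i) => j ->.
    exists (k0 (partial j h0)).
      by exists (partial j h0) => //; exact: smooth_on_partial.
    by move=> P _; rewrite [RHS]derE dl.
  exists (fun=> 0); first by exists (fun=> 0) => //; exact: smooth_on_cst.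
  by move=> P _; rewrite [RHS]derE dr derive0.
Qed.

Lemma pseudo_riemannian_gmetric {R : realType} {p : nat} (O : set 'rV[R]_p) f :
  open O -> smooth_on O f -> pseudo_riemannian (Mdom O) (gmetric f).
Proof.
move=> oO sf; split.
- by apply: (open_comp _ oO) => P _; exact: continuous_lsubmx.
- move=> i j; case: (split_ordP i) => a ->; case: (split_ordP j) => b ->.
  + rewrite [X in smooth_on _ X](_ : _ =
      (fun P => (partial a f * partial b f) (lsubmx P))).
      by apply: smooth_on_lsubmx => //; apply: smooth_onM => //;
         exact: smooth_on_partial.
    by apply/funext => P; rewrite /gmetric block_mxEul mxE.
  + under eq_fun do rewrite /gmetric block_mxEur; exact: smooth_on_cst.
  + under eq_fun do rewrite /gmetric block_mxEdl; exact: smooth_on_cst.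
  + under eq_fun do rewrite /gmetric block_mxEdr; exact: smooth_on_cst.
- move=> P _; rewrite /gmetric tr_block_mx !trmx1 trmx0; congr block_mx.
  by apply/matrixP => i j; rewrite !mxE mulrC.
- move=> P _; rewrite /gmetric; set A := \matrix_(i, j) _.
  have At : A^T = A by apply/matrixP => i j; rewrite !mxE mulrC.
  pose B := - 2^-1 *: (1%:M + A); pose C := 2^-1 *: (1%:M - A).
  have Bt : B^T = B by rewrite /B linearZ linearD /= trmx1 At.
  have Ct : C^T = C by rewrite /C linearZ linearB /= trmx1 At.
  pose E : 'M[R]_(p + p) := block_mx 1%:M B 1%:M C.
  have EE : E *m block_mx A 1%:M 1%:M 0 *m E^T = block_mx (- 1%:M) 0 0 1%:M.
    rewrite /E tr_block_mx !mulmx_block !trmx1 Bt Ct.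
    rewrite !mul1mx !mulmx1 !mulmx0 !addr0 !mul1mx.
    by congr block_mx; rewrite /B /C; apply/matrixP => i j; rewrite !mxE; field.
  exists E => //.
  have : E *m block_mx A 1%:M 1%:M 0 *m E^T \in unitmx.
    by rewrite EE unitmxE det_lblock det1 mulr1 -scaleN1r detZ det1 mulr1
         unitrX// unitrN unitr1.
  by rewrite -mulmxA unitmx_mul => /andP[].
Qed.

(* Main.v *)
Require Import Defs.
From HB Require Import structures.
From mathcomp Require Import all_boot all_order all_algebra.
From mathcomp Require Import all_classical all_reals all_analysis.
From mathcomp Require Import ring.
Import Order.TTheory GRing.Theory Num.Theory.
Import numFieldNormedType.Exports.
Local Open Scope classical_set_scope.
Local Open Scope ring_scope.
Set Implicit Arguments.
Unset Strict Implicit.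
Unset Printing Implicit Defensive.

(** Write f_i for the partial derivatives of f and H for its Hessian.
  Differentiating g(d_i^x, d_j^x) = f_i f_j gives
    nabla_(d_i^x) d_j^x = H_ij sum_l f_l d_l^y,
  all other covariant derivatives of coordinate fields being zero
  ([levi_civita_gmetric]).  Hence the terms quadratic in the Christoffel symbols
  vanish, the third derivatives of f cancel by symmetry of mixed partial
  derivatives ([partialC]), and
    R(d_i^x, d_j^x) d_k^x = sum_l (H_jk H_il - H_ik H_jl) d_l^y.
  So if a and b are the x-components of two tangent vectors, their curvature
  operator maps the x-directions to the y-directions by the alternating matrix
  (bH)^T (aH) - (aH)^T (bH) and kills the y-directions ([curvature_op_gmetric]).

  Products of two such operators are zero, so all the higher order operators
  Theta vanish, and the Stanilov property is automatic.

  Suppose that det H is not zero.  The y-directions are null, so a definite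
  plane projects injectively to the x-directions; then aH and bH are linearly
  independent.  The general linear group acts transitively on pairs of
  independent vectors, and the congruence K' = S^T K S of alternating matrices
  becomes a similarity, by diag(S^T, S^-1), of the operators they define
  ([similar_wedge]).

  Conversely, let H have rank r < p at some point, with r >= 2.  Any two
  independent vectors are the x-components of an orthonormal basis of some
  spacelike plane, and of some timelike plane ([definite_plane]).  Gaussian
  elimination H = L (pid_mx r) U with L and U invertible shows that the rows of
  L^-1 satisfy (row i of L^-1) H = row i of U for i < r, and 0 otherwise.
  Rows 0 and 1 give a nonzero curvature operator, rows 0 and r give 0, and these
  two are not similar. *)

(** * Symmetry of mixed partial derivatives *)

Lemma derive_line {R : realType} {n : nat} (h : 'rV[R]_n -> R) P u (s : R) :
  derivable h (P + s *: u) u ->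
  is_derive s 1 (fun t => h (P + t *: u)) ('D_u h (P + s *: u)).
Proof.
have E : (fun t => t^-1 *: (((fun t => h (P + t *: u)) \o shift s) (t *: (1 : R))
                            - h (P + s *: u))) =
    (fun t => t^-1 *: ((h \o shift (P + s *: u)) (t *: u) - h (P + s *: u))).
  apply/funext => t /=; congr (_ *: (h _ - _)).
  by rewrite scalerDl [t *: 1]mulr1 addrCA.
by move=> d; split; [rewrite /derivable E|rewrite /derive E].
Qed.

Lemma MVT_line {R : realType} {n : nat} (h : 'rV[R]_n -> R) P u (d : R) :
  0 < d -> (forall s, 0 <= s <= d -> derivable h (P + s *: u) u) ->
  exists2 s, 0 <= s <= d & h (P + d *: u) - h P = 'D_u h (P + s *: u) * d.
Proof.
move=> d0 dh.
have [] := @MVT R (fun t => h (P + t *: u)) (fun s => 'D_u h (P + s *: u)) 0 d d0.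
- move=> x; rewrite in_itv /= => /andP[x0 xd]; apply: derive_line; apply: dh.
  by rewrite !ltW.
- apply: derivable_within_continuous => x; rewrite in_itv /= => xd.
  by have [] := derive_line (dh _ xd).
move=> c; rewrite in_itv /= scale0r addr0 subr0 => /andP[c0 cd] ->.
by exists c => //; rewrite !ltW.
Qed.

Lemma derive_translate {R : realType} {n : nat} (h : 'rV[R]_n -> R) Q w u :
  derivable h (Q + w) u ->
  is_derive Q u (fun X => h (X + w)) ('D_u h (Q + w)).
Proof.
have E : (fun t => t^-1 *: (((fun X => h (X + w)) \o shift Q) (t *: u)
                            - h (Q + w))) =
    (fun t => t^-1 *: ((h \o shift (Q + w)) (t *: u) - h (Q + w))).
  by apply/funext => t /=; rewrite addrA.
by move=> d; split; [rewrite /derivable E|rewrite /derive E].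
Qed.

(** The second difference of h over the parallelogram with sides d u and d v is
  d^2 times a mixed derivative at some point of the parallelogram. *)
Lemma mixed_difference {R : realType} {n : nat} (h : 'rV[R]_n -> R) P u v
    (d : R) : 0 < d ->
  (forall s t, 0 <= s <= d -> 0 <= t <= d ->
     derivable h (P + s *: u + t *: v) u /\
     derivable (fun Q => 'D_u h Q) (P + s *: u + t *: v) v) ->
  exists s t, [/\ 0 <= s <= d, 0 <= t <= d &
    h (P + d *: u + d *: v) - h (P + d *: u) - (h (P + d *: v) - h P) =
    'D_v (fun Q => 'D_u h Q) (P + s *: u + t *: v) * d * d].
Proof.
move=> d0 dh.
have dd : 0 <= d <= d by rewrite (ltW d0)/=.
have zd : 0 <= (0 : R) <= d by rewrite (ltW d0) andbT.
(* MVT along u for k, then along v for the derivative of h along u. *)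
pose k Q := h (Q + d *: v) - h Q.
have dk s : 0 <= s <= d -> is_derive (P + s *: u) u k
    ('D_u h (P + s *: u + d *: v) - 'D_u h (P + s *: u)).
  move=> sd; apply: is_deriveB.
    by apply: derive_translate; have [] := dh s d sd dd.
  apply: derivableP; have [] := dh s 0 sd zd.
  by rewrite scale0r addr0.
have [s sd kE] : exists2 s, 0 <= s <= d &
    k (P + d *: u) - k P = 'D_u k (P + s *: u) * d.
  by apply: MVT_line => // s /dk [].
have [t td lE] : exists2 t, 0 <= t <= d &
    'D_u h (P + s *: u + d *: v) - 'D_u h (P + s *: u) =
    'D_v (fun Q => 'D_u h Q) (P + s *: u + t *: v) * d.
  by apply: (@MVT_line R n (fun Q => 'D_u h Q)) => // t td; have [] := dh s t sd td.
exists s, t; split => //.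
rewrite -lE; move: kE; rewrite /k => ->; congr (_ * _).
by have [_ ->] := dk s sd.
Qed.

(** Both mixed derivatives occur as the same second difference quotient, at two
  points that tend to P with the size of the parallelogram; continuity at P
  concludes. *)
Lemma partialC {R : realType} {n : nat} (U : set 'rV[R]_n) h i j P :
  open U -> smooth_on U h -> U P ->
  partial i (partial j h) P = partial j (partial i h) P.
Proof.
move=> oU sh UP.
pose A := partial i (partial j h); pose B := partial j (partial i h).
have cA : {for P, continuous A} by have [] := sh [:: j; i] P UP.
have cB : {for P, continuous B} by have [] := sh [:: i; j] P UP.
rewrite -/(A P) -/(B P); apply/eqP; rewrite -subr_eq0 -normr_eq0.
apply/negPn/negP => ab0.
have e0 : 0 < `|A P - B P| / 2 by rewrite divr_gt0// lt_def ab0 normr_ge0.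
set e := _ / 2 in e0.
have : \forall Q \near P, [/\ U Q, `|A P - A Q| < e & `|B P - B Q| < e].
  have nU : \forall Q \near P, U Q by apply: open_nbhs_nbhs.
  have nA : \forall Q \near P, `|A P - A Q| < e by move/cvgrPdist_lt: cA; apply.
  have nB : \forall Q \near P, `|B P - B Q| < e by move/cvgrPdist_lt: cB; apply.
  by apply: filterS3 nU nA nB => Q.
move=> /nbhs_normP[r r0 Hr].
set u : 'rV[R]_n := delta_mx 0 i; set v : 'rV[R]_n := delta_mx 0 j.
(* This size keeps the whole parallelogram in the ball of radius r. *)
pose d := r / (`|u| + `|v| + 1).
have uv0 : 0 < `|u| + `|v| + 1 by rewrite ltr_wpDl ?addr_ge0.
have d0 : 0 < d by rewrite divr_gt0.
have duv : d * (`|u| + `|v|) < r.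
  by rewrite /d -mulrA gtr_pMr// mulrC ltr_pdivrMr// mul1r ltrDl.
have box s t : 0 <= s <= d -> 0 <= t <= d ->
  [/\ U (P + s *: u + t *: v), `|A P - A (P + s *: u + t *: v)| < e &
      `|B P - B (P + s *: u + t *: v)| < e].
  move=> /andP[s0 sd] /andP[t0 td]; apply: Hr => /=.
  rewrite -addrA opprD addNKr normrN.
  apply: le_lt_trans duv; rewrite (le_trans (ler_normD _ _))// !normrZ !ger0_norm//.
  by rewrite mulrDr lerD// ler_wpM2r.
(* The second difference is symmetric in u and v: evaluate it both ways. *)
have [s [t [sd td E1]]] := @mixed_difference R n h P u v d d0
  (fun s t sd td => conj ((sh [::] _ (let: And3 a _ _ := box s t sd td in a)).2 i)
     ((sh [:: i] _ (let: And3 a _ _ := box s t sd td in a)).2 j)).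
have box' s' t' (sd' : 0 <= s' <= d) (td' : 0 <= t' <= d) : U (P + s' *: v + t' *: u).
  by rewrite addrAC; have [] := box t' s' td' sd'.
have [t' [s' [td' sd' E2]]] := @mixed_difference R n h P v u d d0
  (fun s t sd td => conj ((sh [::] _ (box' s t sd td)).2 j)
     ((sh [:: j] _ (box' s t sd td)).2 i)).
have E : B (P + s *: u + t *: v) = A (P + s' *: u + t' *: v).
  have dd0 : d != 0 by rewrite gt_eqF.
  apply: (mulIf dd0); apply: (mulIf dd0); rewrite -[LHS]E1 (addrAC P (s' *: u)) -[RHS]E2.
  by rewrite (addrAC P (d *: v)); ring.
have [_ _] := box s t sd td; have [_ + _] := box s' t' sd' td'.
rewrite E => aA aB.
move: (splitr `|A P - B P|) aA aB; rewrite -/e.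
move: (e) (A (P + _ + _)) (A P) (B P) => e' x a b ee' ax bx.
have := ler_distD x a b; rewrite ee' leNgt (distrC x b) => /negP[].
exact: ltrD.
Qed.

(** * The curvature of the metric *)

Section Connection.
Context {R : realType} {p : nat}.
Implicit Types (O : set 'rV[R]_p) (f : 'rV[R]_p -> R) (P : 'rV[R]_(p + p)).

Lemma derive_lsubmx f P v :
  'D_v (fun Q : 'rV[R]_(p + p) => f (lsubmx Q)) P = 'D_(lsubmx v) f (lsubmx P).
Proof.
have E : (fun t => t^-1 *: (((fun Q : 'rV[R]_(p + p) => f (lsubmx Q)) \o shift P)
                              (t *: v) - f (lsubmx P))) =
    (fun t => t^-1 *: ((f \o shift (lsubmx P)) (t *: lsubmx v) - f (lsubmx P))).
  apply/funext => t /=; congr (_ *: (f _ - _)).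
  by apply/rowP => q; rewrite !mxE.
by rewrite /derive E.
Qed.

Lemma partial_lsubmx_lshift f (j : 'I_p) P :
  partial (lshift p j) (fun Q : 'rV[R]_(p + p) => f (lsubmx Q)) P =
  partial j f (lsubmx P).
Proof.
rewrite /partial derive_lsubmx; congr ('D_ _ f _); apply/rowP => q.
by rewrite !mxE !eqxx (inj_eq (@lshift_inj _ _)).
Qed.

Lemma partial_lsubmx_rshift f (j : 'I_p) P :
  partial (rshift p j) (fun Q : 'rV[R]_(p + p) => f (lsubmx Q)) P = 0.
Proof.
rewrite /partial derive_lsubmx -[RHS](derive0 f (lsubmx P)); congr ('D_ _ f _).
by apply/rowP => q; rewrite !mxE eq_lrshift.
Qed.

(** The Hessian as a bilinear form on the tangent space, zero on the
  y-directions. *)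
Definition hessian_xx f P : 'M[R]_(p + p) :=
  block_mx (hessian f (lsubmx P)) 0 0 0.

(** The Hessian as an operator v |-> v *m hessian_xy from the x-directions to
  the y-directions. *)
Definition hessian_xy f P : 'M[R]_(p + p) :=
  block_mx 0 (hessian f (lsubmx P)) 0 0.

(** The vector field sum_l (d_l f) d_l^y; it is the metric dual of df. *)
Definition gradient_y f P : 'rV[R]_(p + p) :=
  row_mx 0 (\row_i partial i f (lsubmx P)).

(** Candidate Christoffel symbols: the component along the l-th coordinate field
  of the covariant derivative of the j-th one in the i-th direction. *)
Definition connection f (i j l : 'I_(p + p)) P : R :=
  hessian_xx f P i j * gradient_y f P 0 l.

Lemma hessian_sym O f x : open O -> smooth_on O f -> O x ->
  (hessian f x)^T = hessian f x.
Proof.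
by move=> oO sf Ox; apply/matrixP => i j; rewrite !mxE (partialC _ _ oO sf Ox).
Qed.

Lemma hessian_xx_colr f P a c : hessian_xx f P a (rshift p c) = 0.
Proof.
rewrite /hessian_xx; case: (split_ordP a) => a' ->.
  by rewrite block_mxEur mxE.
by rewrite block_mxEdr mxE.
Qed.

Lemma hessian_xx_rowd f P a c : hessian_xx f P (rshift p a) c = 0.
Proof.
rewrite /hessian_xx; case: (split_ordP c) => c' ->.
  by rewrite block_mxEdl mxE.
by rewrite block_mxEdr mxE.
Qed.

Lemma gmetric_unit f P : gmetric f P \in unitmx.
Proof.
set A := \matrix_(i, j) (partial i f (lsubmx P) * partial j f (lsubmx P)).
have : gmetric f P *m block_mx 0 1%:M 1%:M (- A) = 1%:M.
  rewrite /gmetric -/A mulmx_block !(mulmx0, mulmx1, mul1mx, mul0mx).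
  by rewrite !(add0r, addr0) subrr -scalar_mx_block.
by case/mulmx1_unit.
Qed.

Lemma gradient_gmetric f P :
  gradient_y f P *m gmetric f P = row_mx (\row_i partial i f (lsubmx P)) 0.
Proof.
by rewrite /gradient_y /gmetric mul_row_block !(mul0mx, mulmx1, mulmx0) !add0r.
Qed.

Lemma partial_cst {n : nat} (k : 'I_n) (c : R) Q : partial k (fun=> c) Q = 0.
Proof. by rewrite /partial derive_cst. Qed.

Lemma partialM {n : nat} (U : set 'rV[R]_n) h1 h2 k Q :
  smooth_on U h1 -> smooth_on U h2 -> U Q ->
  partial k (fun X => h1 X * h2 X) Q =
  h1 Q * partial k h2 Q + h2 Q * partial k h1 Q.
Proof.
move=> s1 s2 UQ; have [_ d1] := s1 [::] Q UQ; have [_ d2] := s2 [::] Q UQ.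
by rewrite /partial (deriveM (d1 k) (d2 k)).
Qed.

Lemma levi_civita_gmetric O f P : open O -> smooth_on O f -> Mdom O P ->
  levi_civita_at (gmetric f) P (fun i j l => connection f i j l P).
Proof.
move=> oO sf OP; have Hs := hessian_sym oO sf OP; split=> [i j l|k i j].
  have Hx : (hessian_xx f P)^T = hessian_xx f P.
    by rewrite /hessian_xx tr_block_mx Hs !trmx0.
  by rewrite /connection -{1}Hx mxE.
have gs a b : gmetric f P a b = gmetric f P b a.
  by rewrite -{1}(pr_sym (pseudo_riemannian_gmetric oO sf) OP) mxE.
(* nabla g contracts the connection with g, which lowers gradient_y to df. *)
have -> : \sum_l (connection f k i l P * gmetric f P l j +
                  connection f k j l P * gmetric f P i l) =
    hessian_xx f P k i * (gradient_y f P *m gmetric f P) 0 j +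
    hessian_xx f P k j * (gradient_y f P *m gmetric f P) 0 i.
  rewrite [X in _ = _ * X + _]mxE [X in _ = _ + _ * X]mxE.
  rewrite !mulr_sumr -big_split; apply: eq_bigr => l _ /=.
  by rewrite /connection (gs i l) !mulrA.
rewrite gradient_gmetric.
have rowr (u : 'rV[R]_p) c : row_mx u (0 : 'rV[R]_p) 0 (rshift p c) = 0.
  by rewrite row_mxEr mxE.
have E (a b : 'I_p) : (fun Q : 'rV[R]_(p + p) => gmetric f Q (lshift p a) (lshift p b)) =
    (fun Q => (fun x => partial a f x * partial b f x) (lsubmx Q)).
  by apply/funext => Q; rewrite /gmetric block_mxEul mxE.
have z (a b : 'I_(p + p)) c : (forall Q, gmetric f Q a b = c) ->
    partial k (fun Q => gmetric f Q a b) P = 0.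
  by move=> /funext ->; rewrite partial_cst.
case: (split_ordP i) => a ->; case: (split_ordP j) => b ->.
- rewrite E; case: (split_ordP k) => c ->.
    rewrite (partial_lsubmx_lshift (fun x => partial a f x * partial b f x)).
    rewrite (partialM c (smooth_on_partial a sf) (smooth_on_partial b sf) OP).
    rewrite /hessian_xx !block_mxEul !row_mxEl !mxE.
    by rewrite addrC; congr (_ + _); apply: mulrC.
  rewrite (partial_lsubmx_rshift (fun x => partial a f x * partial b f x)).
  by rewrite /hessian_xx !block_mxEdl !mxE !mul0r addr0.
- rewrite (z (lshift p a) (rshift p b) (a == b)%:R) => [|Q].
    by rewrite rowr hessian_xx_colr mulr0 mul0r addr0.
  by rewrite /gmetric block_mxEur mxE.
- rewrite (z (rshift p a) (lshift p b) (a == b)%:R) => [|Q].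
    by rewrite rowr hessian_xx_colr mulr0 mul0r addr0.
  by rewrite /gmetric block_mxEdl mxE.
- rewrite (z (rshift p a) (rshift p b) 0) => [|Q].
    by rewrite !rowr !mulr0 addr0.
  by rewrite /gmetric block_mxEdr mxE.
Qed.

Lemma christoffel_gmetric O f i j l P : open O -> smooth_on O f -> Mdom O P ->
  christoffel (gmetric f) i j l P = connection f i j l P.
Proof.
move=> oO sf OP; have pr := pseudo_riemannian_gmetric oO sf.
have /(levi_civita_christoffel _ (pr_open pr) (pr_sym pr) OP (gmetric_unit f P)) :=
  levi_civita_gmetric oO sf OP.
by move=> ->.
Qed.

Lemma smooth_hessian_xx O f i j : open O -> smooth_on O f ->
  smooth_on (Mdom O) (fun P => hessian_xx f P i j).
Proof.
move=> oO sf; rewrite /hessian_xx.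
case: (split_ordP i) => a ->; case: (split_ordP j) => b ->.
- under eq_fun do rewrite block_mxEul mxE.
  exact: (smooth_on_lsubmx (h := partial a (partial b f)) oO
           (smooth_on_partial a (smooth_on_partial b sf))).
- under eq_fun do rewrite block_mxEur mxE; exact: smooth_on_cst.
- under eq_fun do rewrite block_mxEdl mxE; exact: smooth_on_cst.
- under eq_fun do rewrite block_mxEdr mxE; exact: smooth_on_cst.
Qed.

Lemma smooth_gradient_y O f l : open O -> smooth_on O f ->
  smooth_on (Mdom O) (fun P => gradient_y f P 0 l).
Proof.
move=> oO sf; rewrite /gradient_y; case: (split_ordP l) => a ->.
  under eq_fun do rewrite row_mxEl mxE; exact: smooth_on_cst.
under eq_fun do rewrite row_mxEr mxE.
exact: (smooth_on_lsubmx (h := partial a f) oO (smooth_on_partial a sf)).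
Qed.

(** The symmetry of the third derivatives of f, which removes them from the
  curvature. *)
Lemma partial_hessian_xxC O f i j k P : open O -> smooth_on O f -> Mdom O P ->
  partial i (fun Q => hessian_xx f Q j k) P =
  partial j (fun Q => hessian_xx f Q i k) P.
Proof.
move=> oO sf OP.
have rowd a c : (fun Q => hessian_xx f Q (rshift p a) c) = fun=> 0.
  by apply/funext => Q; rewrite hessian_xx_rowd.
have colr a c : (fun Q => hessian_xx f Q a (rshift p c)) = fun=> 0.
  by apply/funext => Q; rewrite hessian_xx_colr.
case: (split_ordP k) => c ->; last by rewrite !colr !partial_cst.
have lift a : (fun Q => hessian_xx f Q (lshift p a) (lshift p c)) =
    fun Q => partial a (partial c f) (lsubmx Q).
  by apply/funext => Q; rewrite /hessian_xx block_mxEul mxE.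
case: (split_ordP i) => a ->; case: (split_ordP j) => b ->;
  rewrite ?lift ?rowd ?partial_cst.
- rewrite (partial_lsubmx_lshift (partial b (partial c f))).
  rewrite (partial_lsubmx_lshift (partial a (partial c f))).
  exact: (partialC a b oO (smooth_on_partial c sf) OP).
- by rewrite (partial_lsubmx_rshift (partial a (partial c f))).
- by rewrite (partial_lsubmx_rshift (partial b (partial c f))).
- by [].
Qed.

Lemma partial_gradient_y f k l P :
  partial k (fun Q => gradient_y f Q 0 l) P = hessian_xy f P k l.
Proof.
rewrite /gradient_y /hessian_xy; case: (split_ordP l) => c ->.
  under eq_fun do rewrite row_mxEl mxE.
  rewrite partial_cst; case: (split_ordP k) => a ->;
    by rewrite ?block_mxEul ?block_mxEdl mxE.
under eq_fun do rewrite row_mxEr mxE.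
case: (split_ordP k) => a ->.
  by rewrite (partial_lsubmx_lshift (partial c f)) block_mxEur mxE.
by rewrite (partial_lsubmx_rshift (partial c f)) block_mxEdr mxE.
Qed.

Lemma riemann_gmetric O f i j k l P : open O -> smooth_on O f -> Mdom O P ->
  riemann (gmetric f) i j k l P =
  hessian_xx f P j k * hessian_xy f P i l - hessian_xx f P i k * hessian_xy f P j l.
Proof.
move=> oO sf OP; have pr := pseudo_riemannian_gmetric oO sf.
have oM := pr_open pr.
have dC a b : partial a (christoffel (gmetric f) b k l) P =
    hessian_xx f P b k * hessian_xy f P a l +
    gradient_y f P 0 l * partial a (fun Q => hessian_xx f Q b k) P.
  rewrite (partial_eq_on (h2 := connection f b k l) a oM _ OP); last first.
    by move=> Q OQ; rewrite (christoffel_gmetric _ _ _ oO sf OQ).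
  rewrite -partial_gradient_y.
  exact: (partialM a (smooth_hessian_xx b k oO sf) (smooth_gradient_y l oO sf) OP).
(* gradient_y has only y-components, and hessian_xx kills them. *)
have nil a m : gradient_y f P 0 m * hessian_xx f P a m = 0.
  case: (split_ordP m) => m' ->; last by rewrite hessian_xx_colr mulr0.
  by rewrite /gradient_y row_mxEl mxE mul0r.
rewrite /riemann big1 => [|m _].
  by rewrite !dC (partial_hessian_xxC i j k oO sf OP); ring.
rewrite !(christoffel_gmetric _ _ _ oO sf OP) /connection.
have z a b : hessian_xx f P a k * gradient_y f P 0 m *
    (hessian_xx f P b m * gradient_y f P 0 l) = 0.
  by rewrite -mulrA (mulrA (gradient_y _ _ _ _)) nil mul0r mulr0.
by rewrite !z subr0.
Qed.

Lemma curvature_op_gmetric O f P x y : open O -> smooth_on O f -> Mdom O P ->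
  curvature_op (gmetric f) P x y =
  block_mx 0 ((lsubmx y *m hessian f (lsubmx P))^T *m (lsubmx x *m hessian f (lsubmx P))
     - (lsubmx x *m hessian f (lsubmx P))^T *m (lsubmx y *m hessian f (lsubmx P))) 0 0.
Proof.
move=> oO sf OP.
have -> : curvature_op (gmetric f) P x y =
    (y *m hessian_xx f P)^T *m (x *m hessian_xy f P)
    - (x *m hessian_xx f P)^T *m (y *m hessian_xy f P).
  apply/matrixP => k l; rewrite !mxE !big_ord1 !mxE.
  rewrite !mulr_suml; under [in RHS]eq_bigr do rewrite mulr_sumr.
  under [X in _ = _ - X]eq_bigr do rewrite mulr_sumr.
  rewrite [X in _ = X - _]exchange_big -sumrB; apply: eq_bigr => i _ /=.
  rewrite -sumrB; apply: eq_bigr => j _.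
  by rewrite (riemann_gmetric _ _ _ _ oO sf OP); ring.
rewrite -{1 2}(hsubmxK x) -{1 2}(hsubmxK y) /hessian_xx /hessian_xy.
rewrite !mul_row_block !(mulmx0, addr0) !tr_row_mx !mul_col_row !trmx0.
by rewrite !(mulmx0, mul0mx) opp_block_mx add_block_mx !oppr0 !addr0.
Qed.

End Connection.

(** * Alternating matrices of rank two *)

(** The alternating matrix of the bivector spanned by a and b; as an operator on
  row vectors it maps v to (v . b) a - (v . a) b. *)
Definition wedge_mx {R : pzRingType} {p : nat} (a b : 'rV[R]_p) : 'M[R]_p :=
  b^T *m a - a^T *m b.

Lemma wedge_mxE {R : comNzRingType} {p : nat} (a b : 'rV[R]_p) :
  wedge_mx a b =
  (col_mx a b)^T *m block_mx 0 (- 1%:M) 1%:M 0 *m col_mx a b.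
Proof.
rewrite tr_col_mx mul_row_block mul_row_col !mulmx0 !mulmx1 mulmxN mulmx1.
by rewrite add0r addr0 mulNmx.
Qed.

Lemma wedge_row_neq0 {F : fieldType} {p : nat} (U : 'M[F]_p) (i j : 'I_p) :
  U \in unitmx -> i != j -> wedge_mx (row i U) (row j U) != 0.
Proof.
move=> uU ij; have -> : wedge_mx (row i U) (row j U) =
    U^T *m (delta_mx j i - delta_mx i j) *m U.
  rewrite /wedge_mx !rowE !trmx_mul !trmx_delta mulmxBr mulmxBl.
  by rewrite -(mul_delta_mx (0 : 'I_1) j i) -(mul_delta_mx (0 : 'I_1) i j) !mulmxA.
apply/eqP => /(congr1 (mulmx^~ (invmx U))); rewrite mulmxK// mul0mx.
move=> /(congr1 (mulmx (invmx U^T))); rewrite mulKmx ?unitmx_tr// mulmx0.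
move=> /matrixP/(_ j i); rewrite !mxE !eqxx eq_sym (negPf ij) /= subr0.
by move/eqP; rewrite oner_eq0.
Qed.

(** The general linear group acts transitively on m-tuples of independent
  vectors. *)
Lemma row_free_transitive {F : fieldType} {m n : nat} (A B : 'M[F]_(m, n)) :
  row_free A -> row_free B -> exists2 S : 'M[F]_n, S \in unitmx & B = A *m S.
Proof.
move=> fA fB; have E : A *m (pinvmx A *m B) = B by rewrite mulmxA mulmxVp// mul1mx.
have [|S uS] := @complete_unitmx _ _ _ A (pinvmx A *m B).
  by rewrite E; move: fA fB => /eqP -> /eqP.
by rewrite E => ->; exists S.
Qed.

Lemma similar_wedge {F : fieldType} {p : nat} (a b a' b' : 'rV[F]_p) :
  row_free (col_mx a b) -> row_free (col_mx a' b') ->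
  similar_in unitmx (block_mx 0 (wedge_mx a b) 0 0 : 'M[F]_(p + p))
                    (block_mx 0 (wedge_mx a' b') 0 0).
Proof.
move=> fe fe'; have [S uS E] := row_free_transitive fe fe'.
have K : wedge_mx a' b' = S^T *m wedge_mx a b *m S.
  by rewrite !wedge_mxE E trmx_mul !mulmxA.
have uP : block_mx S^T 0 0 (invmx S) \in unitmx.
  by rewrite unitmxE det_ublock unitrM -!unitmxE unitmx_tr uS unitmx_inv uS.
exists (block_mx S^T 0 0 (invmx S)) => //; apply/similarP => //.
rewrite !mulmx_block !(mulmx0, mul0mx, addr0, add0r) K.
by rewrite -!mulmxA mulmxV// mulmx1.
Qed.

(** * Definite planes and the main properties *)

(** The operator Theta is zero, since curvature operators multiply to zero. *)
Lemma jordan_stanilov_gmetric {R : realType} {p k : nat} (O : set 'rV[R]_p) f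
    (causal : 'M[R]_(p + p) -> {vspace 'rV[R]_(p + p)} -> Prop) :
  open O -> smooth_on O f -> jordan_stanilov causal k (Mdom O) (gmetric f).
Proof.
move=> oO sf P OP W W' e e' _ _ _ _.
have z (e0 : k.-tuple _) : stanilov_op (gmetric f) P e0 = 0.
  apply: big1 => i _; apply: big1 => j _.
  rewrite !(curvature_op_gmetric _ _ oO sf OP) mulmx_block.
  by rewrite !(mulmx0, mul0mx) !addr0 block_mx0.
rewrite !z; exists 1%:M; first exact: unitmx1.
by apply/similarP; rewrite ?unitmx1// mulmx0 mul0mx.
Qed.

Section Planes.
Context {R : realType} {p : nat}.
Implicit Types (O : set 'rV[R]_p) (f : 'rV[R]_p -> R) (P : 'rV[R]_(p + p)).

Lemma lsubmx0_null f P w : lsubmx w = 0 -> inner (gmetric f P) w w = 0.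
Proof.
move=> w0; rewrite /inner -[w]hsubmxK w0 /gmetric mul_row_block tr_row_mx mul_row_col.
by rewrite trmx0 !(mul0mx, mulmx0) !add0r mul0mx mxE.
Qed.

(** A space without nonzero null vectors projects injectively to the
  x-directions, and an invertible H keeps the projections independent. *)
Lemma nonnull_row_free f P (H : 'M[R]_p) (W : {vspace 'rV[R]_(p + p)})
    (e : 2.-tuple 'rV[R]_(p + p)) :
  H \in unitmx ->
  (forall v, v \in W -> v != 0 -> inner (gmetric f P) v v != 0) ->
  basis_of W e ->
  row_free (col_mx (lsubmx (tnth e ord0) *m H) (lsubmx (tnth e ord_max) *m H)).
Proof.
move=> uH nn be; apply: inj_row_free => v.
rewrite -[v]hsubmxK mul_row_col.
rewrite [lsubmx v]mx11_scalar [rsubmx v]mx11_scalar !mul_scalar_mx.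
set c := lsubmx v 0 0; set d := rsubmx v 0 0; set x := tnth e _; set y := tnth e _.
rewrite !scalemxAl -mulmxDl => /(congr1 (mulmx^~ (invmx H))).
rewrite mul0mx mulmxK// => E0.
have ew : lsubmx (c *: x + d *: y) = 0.
  by rewrite linearD !linearZ.
have Ww : c *: x + d *: y \in W.
  by rewrite memvD// memvZ// (basis_mem be)// mem_tnth.
have w0 : c *: x + d *: y = 0.
  apply/eqP; apply/negPn/negP => /(nn _ Ww).
  by rewrite lsubmx0_null// eqxx.
have /freeP fe := basis_free be.
have {}fe := fe (fun i => if i == ord0 then c else d).
have s0 : \sum_(i < 2) (if i == ord0 then c else d) *: e`_i = 0.
  by rewrite big_ord_recl big_ord1 /= -[RHS]w0 /x /y !(tnth_nth 0).
have /= -> := fe s0 ord0; have /= -> := fe s0 ord_max.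
by rewrite !raddf0 row_mx0.
Qed.

(** Spacelike for eps = 1 and timelike for eps = -1. *)
Definition definite (eps : R) (G : 'M[R]_(p + p)) (W : {vspace 'rV[R]_(p + p)}) :=
  forall v, v \in W -> v != 0 -> 0 < eps * inner G v v.

(** The metric on the graph of a symmetric map from the x- to the y-directions. *)
Lemma innerE f P (C : 'M[R]_p) a b : C^T = C ->
  inner (gmetric f P) (row_mx a (a *m C)) (row_mx b (b *m C)) =
  (a *m (ulsubmx (gmetric f P) + C + C) *m b^T) 0 0.
Proof.
move=> Cs; rewrite /inner tr_row_mx trmx_mul Cs.
rewrite /gmetric mul_row_block mul_row_col block_mxKul !mulmx1 mulmx0 addr0.
by rewrite mulmxA -mulmxDl !mulmxDr.
Qed.

Lemma ulsubmx_gmetric_sym f P : (ulsubmx (gmetric f P))^T = ulsubmx (gmetric f P).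
Proof. by rewrite /gmetric block_mxKul; apply/matrixP => i j; rewrite !mxE mulrC. Qed.

(** Any two distinct rows of an invertible matrix T are the x-components of an
  orthonormal basis of a plane of prescribed sign. *)
Lemma definite_plane f P (eps : R) (T : 'M[R]_p) (i j : 'I_p) :
  `|eps| = 1 -> T \in unitmx -> i != j ->
  exists W, exists e : 2.-tuple 'rV[R]_(p + p),
    [/\ definite eps (gmetric f P) W, orthonormal_basis (gmetric f P) W e,
        lsubmx (tnth e ord0) = row i T & lsubmx (tnth e ord_max) = row j T].
Proof.
move=> e1 uT ij.
have ee : eps * eps = 1 by rewrite -expr2 -real_normK ?num_real// e1 expr1n.
(* The Gram matrix of the metric on the graph of C is A + 2C; this C makes it
   eps S, where S is the inner product for which the rows of T are orthonormal. *)
pose A := ulsubmx (gmetric f P).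
pose S := invmx T *m (invmx T)^T.
pose C := 2^-1 *: (eps *: S - A).
have Cs : C^T = C.
  rewrite /C linearZ /= linearB /= linearZ /= ulsubmx_gmetric_sym.
  by rewrite /S trmx_mul trmxK.
pose V (c : 'rV[R]_p) := row_mx (c *m T) (c *m T *m C).
have Vin c d : inner (gmetric f P) (V c) (V d) = eps * (c *m d^T) 0 0.
  rewrite innerE// -/A -addrA -mulr2n -scaler_nat /C scalerA mulfV ?scale1r ?pnatr_eq0//.
  rewrite addrC subrK -scalemxAr -scalemxAl [LHS]mxE; congr (_ * _).
  congr (fun_of_matrix _ 0 0).
  by rewrite trmx_mul /S !mulmxA mulmxK// -(mulmxA c) -trmx_mul mulmxV// trmx1 mulmx1.
have VD c d x y : V (x *: c + y *: d) = x *: V c + y *: V d.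
  by rewrite /V !mulmxDl -!scalemxAl !scale_row_mx add_row_mx.
have V0 c : V c = 0 -> c = 0.
  move=> /(congr1 lsubmx); rewrite /V row_mxKl linear0 => /(congr1 (mulmx^~ (invmx T))).
  by rewrite mulmxK// mul0mx.
pose di : 'rV[R]_p := delta_mx 0 i; pose dj : 'rV[R]_p := delta_mx 0 j.
have dd (a b : 'I_p) : (delta_mx 0 a *m (delta_mx 0 b)^T : 'M[R]_1) 0 0 = (a == b)%:R.
  by rewrite trmx_delta mul_delta_mx_cond mulrb; case: eqP => _; rewrite mxE.
pose e : 2.-tuple 'rV[R]_(p + p) := [tuple V di; V dj].
have en0 : tnth e ord0 = V di by [].
have en1 : tnth e ord_max = V dj by [].
have fe : free e.
  apply/freeP => k; rewrite big_ord_recl big_ord1 /= -VD => /V0 /rowP k0.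
  have ki := k0 i; have kj := k0 j.
  rewrite !mxE !eqxx /= (negPf ij) mulr1 mulr0 addr0 in ki.
  rewrite !mxE !eqxx /= eq_sym (negPf ij) mulr1 mulr0 add0r in kj.
  by move=> a; case: (unliftP ord0 a) => [b ->|->]; rewrite ?(ord1 b).
exists <<e>>%VS, e; split.
- move=> v /coord_span ->; rewrite big_ord_recl big_ord1 /= -VD => v0.
  rewrite Vin mulrA ee mul1r mxE; set c := _ + _ in v0 *; clearbody c.
  have [a ca] : exists a, c 0 a != 0.
    apply/existsP; apply: contraNT v0; rewrite negb_exists => /forallP c0.
    have -> : c = 0 by apply/rowP => a; rewrite [RHS]mxE; exact/eqP/negPn/c0.
    by rewrite /V !mul0mx row_mx0.
  rewrite (bigD1 a)//= mxE ltr_wpDr//.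
    by apply: sumr_ge0 => b _; rewrite mxE -expr2 sqr_ge0.
  by rewrite -expr2 exprn_even_gt0.
- split.
  + by rewrite /basis_of eqxx.
  + move=> a; case: (unliftP ord0 a) => [b ->|->]; rewrite ?(ord1 b).
      by rewrite [tnth _ _]en1 Vin dd eqxx mulr1.
    by rewrite en0 Vin dd eqxx mulr1.
  + move=> a b; case: (unliftP ord0 a) => [a' ->|->]; case: (unliftP ord0 b) => [b' ->|->];
      rewrite ?(ord1 a') ?(ord1 b') ?eqxx// => _.
      by rewrite [tnth _ (lift _ _)]en1 en0 Vin dd eq_sym (negPf ij) mulr0.
    by rewrite [tnth _ (lift _ _)]en1 en0 Vin dd (negPf ij) mulr0.
- by rewrite en0 row_mxKl rowE.
- by rewrite en1 row_mxKl rowE.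
Qed.

Lemma jordan_IP_gmetric O f eps
    (causal : 'M[R]_(p + p) -> {vspace 'rV[R]_(p + p)} -> Prop) :
  open O -> smooth_on O f ->
  (forall x, O x -> (2 <= \rank (hessian f x))%N) ->
  `|eps| = 1 -> (forall G W, causal G W <-> definite eps G W) ->
  jordan_ivanov_petrova causal (Mdom O) (gmetric f) <->
  (forall x, O x -> \det (hessian f x) != 0).
Proof.
move=> oO sf rk e1 cE; split=> [IP x Ox|dH P OP W W' e e' cW cW' [be _ _] [be' _ _]].
- apply/negP => /eqP dH0.
  set H := hessian f x in dH0 *; pose P : 'rV[R]_(p + p) := row_mx x 0.
  have Px : lsubmx P = x by rewrite row_mxKl.
  have OP : Mdom O P by rewrite /Mdom /= Px.
  have r2 : (2 <= \rank H)%N := rk _ Ox.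
  have rp : (\rank H < p)%N.
    rewrite ltn_neqAle rank_leq_row andbT; apply/negP => full.
    have : H \in unitmx by rewrite -row_free_unit.
    by rewrite unitmxE dH0 unitr0.
  (* In the basis given by the rows of T, H becomes pid_mx r *m U. *)
  pose T := invmx (col_ebase H); pose U := row_ebase H.
  have uT : T \in unitmx by rewrite unitmx_inv col_ebase_unit.
  have uU : U \in unitmx := row_ebase_unit H.
  have TH : T *m H = pid_mx (\rank H) *m U.
    by rewrite -{1}(mulmx_ebase H) -!mulmxA mulKmx// col_ebase_unit.
  have rowTH (i : 'I_p) : row i T *m H = if (i < \rank H)%N then row i U else 0.
    rewrite -row_mul TH row_mul; case: ifP => ir.
      rewrite [RHS]rowE; congr (_ *m _); apply/rowP => a.
      by rewrite !mxE eqxx /= ir andbT eq_sym.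
    rewrite (_ : row i _ = 0) ?mul0mx//; apply/rowP => a.
    by rewrite !mxE ir andbF.
  have p1 : (1 < p)%N := leq_trans r2 (ltnW rp).
  pose i0 := Ordinal (ltnW p1); pose i1 := Ordinal p1; pose il := Ordinal rp.
  have i01 : i0 != i1 by [].
  have i0l : i0 != il by rewrite -val_eqE /= eq_sym -lt0n ltnW.
  have [W [e [dW oe a0 a1]]] := definite_plane f P e1 uT i01.
  have [W' [e' [dW' oe' b0 b1]]] := definite_plane f P e1 uT i0l.
  have [S uS] := IP P OP W W' e e' ((cE _ _).2 dW) ((cE _ _).2 dW') oe oe'.
  rewrite /skew_curvature_op !(curvature_op_gmetric _ _ oO sf OP) a0 a1 b0 b1 Px -/H.
  rewrite !rowTH /= ltnn (ltnW r2) r2 trmx0 mul0mx mulmx0 subr0 block_mx0.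
  (* The second operator is 0, hence so is the first, contradicting the
     independence of rows 0 and 1 of U. *)
  move=> /similarP -/(_ uS); rewrite mul0mx => /(congr1 (mulmx (invmx S))).
  rewrite mulKmx// mulmx0 => /(congr1 ursubmx).
  rewrite block_mxKur -[X in ursubmx X](block_mx0 _ p p p p) block_mxKur; apply/eqP.
  exact: wedge_row_neq0.
- have nn W0 : causal (gmetric f P) W0 ->
    forall v, v \in W0 -> v != 0 -> inner (gmetric f P) v v != 0.
    move=> /cE dW0 v vW v0; apply: contraTneq (dW0 v vW v0) => ->.
    by rewrite mulr0 ltxx.
  have uH : hessian f (lsubmx P) \in unitmx.
    by rewrite unitmxE unitfE; apply: dH.
  rewrite /skew_curvature_op !(curvature_op_gmetric _ _ oO sf OP).
  by apply: similar_wedge; [apply: nonnull_row_free uH (nn _ cW) be|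
    apply: nonnull_row_free uH (nn _ cW') be'].
Qed.

End Planes.

Theorem theorem1p6 (R : realType) (p : nat) (hp : (2 <= p)%N)
  (O : set 'rV[R]_p) (hOopen : open O) (hOconn : connected O)
  (f : 'rV[R]_p -> R) (hf : smooth_on O f)
  (hrank : forall x, O x -> (2 <= \rank (hessian f x))%N) :
  [/\ spacelike_jordan_IP (Mdom O) (gmetric f) <->
        (forall x, O x -> \det (hessian f x) != 0),
      timelike_jordan_IP (Mdom O) (gmetric f) <->
        (forall x, O x -> \det (hessian f x) != 0) &
      forall k : nat, (2 <= k <= p)%N ->
        spacelike_jordan_stanilov k (Mdom O) (gmetric f) /\
        timelike_jordan_stanilov k (Mdom O) (gmetric f)].
Proof.
have sp (G : 'M[R]_(p + p)) W : spacelike G W <-> definite 1 G W.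
  by split=> h v vW v0; [rewrite mul1r|rewrite -(mul1r (inner _ _ _))]; apply: h.
have tl (G : 'M[R]_(p + p)) W : timelike G W <-> definite (- 1) G W.
  split=> h v vW v0; first by rewrite mulN1r oppr_gt0; apply: h.
  by rewrite -oppr_gt0 -mulN1r; apply: h.
split.
- by apply: (jordan_IP_gmetric hOopen hf hrank _ sp); rewrite normr1.
- by apply: (jordan_IP_gmetric hOopen hf hrank _ tl); rewrite normrN1.
- by move=> k _; split; apply: jordan_stanilov_gmetric.
Qed.
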